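(* For every interpretation $(\mathcal{M},\gamma)$ and all formulas $\varphi,\psi\in Fm$: $(\mathcal{M},\gamma)\vDash\varphi\equiv\psi$ if and only if $\gamma(\varphi)=\gamma(\psi)$.
   Context: Formulas $Fm$ are generated from an infinite set $V$ of propositional variables by the constant $\bot$, binary connectives $\rightarrow,\vee,\wedge$ and unary $\square$; $\varphi\equiv\psi$ abbreviates $\square(\varphi\rightarrow\psi)\wedge\square(\psi\rightarrow\varphi)$. A Heyting algebra $(M,f_\top,f_\bot,f_\vee,f_\wedge,f_\rightarrow)$ is a bounded lattice with top $f_\top$, bottom $f_\bot$, join $f_\vee$, meet $f_\wedge$, order $\le$, and $f_\rightarrow(m,m')$ the greatest $m''$ with $f_\wedge(m,m'')\le m'$. A filter is a non-empty upward closed $F\subseteq M$ closed under $f_\wedge$ with $f_\bot\notin F$; an ultrafilter is a filter maximal under inclusion. A model $\mathcal{M}=(M,\mathit{TRUE},f_\top,f_\bot,f_\rightarrow,f_\vee,f_\wedge,f_\square)$ is a Heyting algebra with an ultrafilter $\mathit{TRUE}$ and a unary operation $f_\square$ such that for all $m,m',m''\in M$: (1) $f_\square(m)\le m$; (2) $f_\square(f_\rightarrow(m,m'))\le f_\rightarrow(f_\square(f_\rightarrow(m',m'')),f_\square(f_\rightarrow(m,m'')))$; (3) $f_\square(f_\vee(m,m'))\le f_\vee(f_\square(m),f_\square(m'))$; (4) $f_\square(m)\in\mathit{TRUE}\iff m=f_\top$. An assignment $\gamma:V\to M$ extends to $Fm$ by $\gamma(\bot)=f_\bot$, $\gamma(\square\varphi)=f_\square(\gamma(\varphi))$,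 $\gamma(\varphi*\psi)=f_*(\gamma(\varphi),\gamma(\psi))$ for $*\in\{\rightarrow,\vee,\wedge\}$. An interpretation is a pair $(\mathcal{M},\gamma)$, and $(\mathcal{M},\gamma)\vDash\varphi$ means $\gamma(\varphi)\in\mathit{TRUE}$. *)

(* Defs.v *)
From mathcomp Require Import all_boot all_order.
From mathcomp Require Import boolp classical_sets functions cardinality.

Set Implicit Arguments.
Unset Strict Implicit.
Unset Printing Implicit Defensive.

Local Open Scope order_scope.

Inductive formula (V : Type) : Type :=
| Var of V
| Bot
| Imp of formula V & formula V
| Or of formula V & formula V
| And of formula V & formula V
| Box of formula V.

Arguments Bot {V}.

(* [Equiv phi psi] is an object-language formula (propositional identity),
   not a meta-level relation on formulas. *)
Definition Equiv (V : Type) (phi psi : formula V) : formula V :=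
  And (Box (Imp phi psi)) (Box (Imp psi phi)).

Record heytingAlgebra (d : Order.disp_t) := HeytingAlgebra {
  ha_lattice :> tbLatticeType d;
  himp : ha_lattice -> ha_lattice -> ha_lattice;
  himp_greatest : forall m m' : ha_lattice,
    Order.meet m (himp m m') <= m' /\
    (forall m'', Order.meet m m'' <= m' -> m'' <= himp m m')
}.

Definition lattice_filter (d : Order.disp_t) (M : heytingAlgebra d)
    (F : set M) : Prop :=
  [/\ exists m, F m,
      forall m m', F m -> m <= m' -> F m',
      forall m m', F m -> F m' -> F (Order.meet m m')
    & ~ F (Order.bottom : M)].

Definition lattice_ultrafilter (d : Order.disp_t) (M : heytingAlgebra d)
    (F : set M) : Prop :=
  lattice_filter F /\
  (forall G : set M, lattice_filter G -> (F `<=` G)%classic -> G = F).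

Record model (d : Order.disp_t) := Model {
  model_ha :> heytingAlgebra d;
  TRUE : set model_ha;
  fbox : model_ha -> model_ha;
  TRUE_ultrafilter : lattice_ultrafilter TRUE;
  fbox_le : forall m : model_ha, fbox m <= m;
  fbox_imp : forall m m' m'' : model_ha,
    fbox (himp m m') <= himp (fbox (himp m' m'')) (fbox (himp m m''));
  fbox_join : forall m m' : model_ha,
    fbox (Order.join m m') <= Order.join (fbox m) (fbox m');
  fbox_TRUE : forall m : model_ha, TRUE (fbox m) <-> m = Order.top
}.

Record interpretation (V : Type) (d : Order.disp_t) := Interpretation {
  imodel : model d;
  assignment : V -> imodel
}.

Fixpoint eval (V : Type) (d : Order.disp_t) (M : model d) (g : V -> M)
    (phi : formula V) : M :=
  match phi with
  | Var x => g x
  | Bot => Order.bottom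
  | Imp phi1 phi2 => himp (eval g phi1) (eval g phi2)
  | Or phi1 phi2 => Order.join (eval g phi1) (eval g phi2)
  | And phi1 phi2 => Order.meet (eval g phi1) (eval g phi2)
  | Box phi1 => fbox (eval g phi1)
  end.

Definition ival (V : Type) (d : Order.disp_t) (I : interpretation V d) :
    formula V -> imodel I :=
  eval (assignment I).

Definition satisfies (V : Type) (d : Order.disp_t) (I : interpretation V d)
    (phi : formula V) : Prop :=
  TRUE (ival I phi).

(* Main.v *)
Require Import Defs.
From mathcomp Require Import all_boot all_order.
From mathcomp Require Import boolp classical_sets functions cardinality.

Import Order.LTheory.

(** A filter contains a meet exactly when it contains both factors ([filter_meet]), so
    [Equiv phi psi] holds iff both boxed implications lie in [TRUE]. By [fbox_TRUE] this forces each
    implication to equal the top, which by [himp_eq_top] means an inequality between the two values.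
    The two inequalities together are equality, by antisymmetry. *)

Lemma himp_eq_top (d : Order.disp_t) (M : heytingAlgebra d) (m m' : M) :
  himp m m' = Order.top <-> (m <= m')%O.
Proof.
have [mp greatest] := himp_greatest m m'; split=> [imp1|le_mm'].
  by move: mp; rewrite imp1 meetx1.
(* Maximality of [himp m m'] is used with the top element as candidate, whose meet with [m] is [m]
   itself. *)
by apply/eqP; rewrite -le1x greatest // meetx1.
Qed.

Lemma filter_meet (d : Order.disp_t) (M : heytingAlgebra d) (F : set M)
    (m m' : M) :
  lattice_filter F -> F (Order.meet m m') <-> F m /\ F m'.
Proof.
case=> _ up meetF _; split=> [Fmm'|[Fm Fm']]; last exact: meetF.
by split; apply: up Fmm' _; [apply: leIl|apply: leIr].
Qed.

Theorem theorem3p6 (V : Type) (V_infinite : infinite_set [set: V]%classic)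
    (d : Order.disp_t) (I : interpretation V d) (phi psi : formula V) :
  satisfies I (Equiv phi psi) <-> ival I phi = ival I psi.
Proof.
have [filterT _] := TRUE_ultrafilter (imodel I).
rewrite /satisfies /ival /= filter_meet // !fbox_TRUE !himp_eq_top.
split=> [[le1 le2]|->]; last by rewrite lexx.
by apply: le_anti; rewrite le1 le2.
Qed.
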